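(* Let $T>0$, $m,N\in\mathbb N$, let $e_i\in\mathbb R^m$ be the $i$th unit vector, $X=(X_1,\dots,X_m)^\top:[0,T]\to\mathbb R^m$ a continuous path of bounded variation and $S^N(X)$ its truncated signature of order $N$. Let $n=\sum_{k=0}^{N}m^k=\frac{m^{N+1}-1}{m-1}$ and $\tilde n=\sum_{k=0}^{N-1}m^k=\frac{m^N-1}{m-1}$, and define matrices $A_i\in\mathbb R^{n\times n}$, $i=1,\dots,m$, by $$A_i=\begin{bmatrix}\tilde A_i & O_{n,n-\tilde n}\end{bmatrix},\qquad \tilde A_i=\begin{bmatrix}O_{1,\tilde n}\\ \operatorname{blkdiag}(\underbrace{e_i,\dots,e_i}_{\tilde n\text{ times}})\end{bmatrix}\in\mathbb R^{n\times\tilde n}.$$ Then $S^N(X)$ satisfies, for $t\in[0,T]$, $$S^N_{0,t}(X)=\mathbf e_1+\sum_{i=1}^m\int_0^t A_iS^N_{0,s}(X)\,\mathrm dX_i(s),$$ where $\mathbf e_1$ is the first unit vector in $\mathbb R^n$.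
   Context: $O_{n_1,n_2}\in\mathbb R^{n_1\times n_2}$ is the zero matrix; $\operatorname{blkdiag}(e_i,\dots,e_i)$ is the $m\tilde n\times\tilde n$ block diagonal matrix whose diagonal blocks are the column vectors $e_i\in\mathbb R^{m\times 1}$. Integrals with respect to $X_i$ are Riemann–Stieltjes integrals. For $m=1$ the fractions are understood as the corresponding sums. Truncated signature: for a continuous path of bounded variation $X:[0,T]\to\mathbb R^{m}$ and $0\le a<b\le T$, the iterated (Riemann–Stieltjes) integrals are $X^{(k)}_{a,b}=\int\cdots\int_{a<s_1<\cdots<s_k<b}\mathrm dX(s_1)\otimes\cdots\otimes \mathrm dX(s_k)\in\mathbb R^{m^k}$, where $\otimes$ is the Kronecker product, and $S^N_{a,b}(X)=(1,{X^{(1)}_{a,b}}^\top,\dots,{X^{(N)}_{a,b}}^\top)^\top\in\mathbb R^n$. For $a=b$ the iterated integrals vanish, so $S^N_{a,a}(X)=(1,0,\dots,0)^\top$. *)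

(* Defs.v *)
From HB Require Import structures.
From mathcomp Require Import all_boot all_order all_algebra.
From mathcomp Require Import all_classical all_reals all_analysis.
From mathcomp Require Import mxtens.
Set Implicit Arguments.
Unset Strict Implicit.
Unset Printing Implicit Defensive.
Import Order.TTheory GRing.Theory Num.Theory.
Import numFieldNormedType.Exports.
Local Open Scope classical_set_scope.
Local Open Scope ring_scope.

Section RiemannStieltjes.
Context {R : realType}.
Implicit Types (a b : R) (s : seq R) (xi : nat -> R).

(* A partition a = x_0 < x_1 < ... < x_p = b is coded, as in numfun.v, by
   s = [:: x_1; ...; x_p] with [itv_partition a b s]; for a = b the only
   partition is [::].  [node a s j] is x_j for j <= p. *)
Definition node a s (j : nat) : R := nth (last a s) (a :: s) j.

(* [variation] of numfun.v is restricted to real-valued functions. *)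
Definition bounded_variation_path {V : normedModType R} a b (X : R -> V) :=
  has_ubound [set \sum_(0 <= j < size s) `|X (node a s j.+1) - X (node a s j)|
             | s in itv_partition a b].

Definition tagged_partition a b s xi :=
  itv_partition a b s /\
  forall j, (j < size s)%N -> node a s j <= xi j <= node a s j.+1.

Definition finer_than (delta : R) a s :=
  forall j, (j < size s)%N -> node a s j.+1 - node a s j < delta.

(* The integrand and the integrator may both be vector valued; [op] is the
   product by which a value of f multiplies an increment of g. *)
Definition RS_sum {V : Type} {Z : zmodType} {W : normedModType R}
    (op : V -> Z -> W) (f : R -> V) (g : R -> Z) a s xi : W :=
  \sum_(0 <= j < size s) op (f (xi j)) (g (node a s j.+1) - g (node a s j)).

Definition is_RS_integral {V : Type} {Z : zmodType} {W : normedModType R}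
    (op : V -> Z -> W) (f : R -> V) (g : R -> Z) a b (l : W) :=
  forall eps : R, 0 < eps -> exists2 delta : R, 0 < delta &
    forall s xi, tagged_partition a b s xi -> finer_than delta a s ->
      `|RS_sum op f g a s xi - l| < eps.

Definition RS_integrable {V : Type} {Z : zmodType} {W : normedModType R}
    (op : V -> Z -> W) (f : R -> V) (g : R -> Z) a b :=
  exists l, is_RS_integral op f g a b l.

(* The value is 0 when the integral does not exist. *)
Definition RS_integral {V : Type} {Z : zmodType} {W : normedModType R}
    (op : V -> Z -> W) (f : R -> V) (g : R -> Z) a b : W :=
  xget 0 [set l | is_RS_integral op f g a b l].

End RiemannStieltjes.

Definition vscale {R : realType} {p : nat} (v : 'cV[R]_p) (x : R) : 'cV[R]_p :=
  x *: v.

(* [tensmx] is the Kronecker product, with row index i * m + j for the pair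
   (i, j); the number of columns 1 * 1 is convertible to 1. *)
Definition kron {R : realType} {p m : nat} (u : 'cV[R]_p) (v : 'cV[R]_m) :
  'cV[R]_(p * m) := tensmx u v.

(* [iterated_integral X a k b] integrates over a < s_1 < ... < s_k < b, the
   outermost variable being s_k. *)
Fixpoint iterated_integral {R : realType} {m : nat} (X : R -> 'cV[R]_m)
    (a : R) (k : nat) : R -> 'cV[R]_(m ^ k) :=
  match k return R -> 'cV[R]_(m ^ k) with
  | 0 => fun=> const_mx 1
  | k'.+1 => fun b => castmx (esym (expnSr m k'), erefl 1%N)
      (RS_integral kron (iterated_integral X a k') X a b)
  end.

Definition sigdim (m N : nat) : nat := (\sum_(k < N) m ^ k)%N.

Definition signature {R : realType} {m : nat} (X : R -> 'cV[R]_m) (N : nat)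
    (a b : R) : 'cV[R]_(sigdim m N.+1) :=
  \mxcol_(k < N.+1) iterated_integral X a k b.

Definition blkdiag {R : realType} {p q : nat} (r : nat) (B : 'I_r -> 'M[R]_(p, q)) :
    'M[R]_(\sum_(j < r) p, \sum_(k < r) q) :=
  \mxblock_(j, k) (if j == k then B j else 0).

Lemma sum1_ord_id (r : nat) : (\sum_(k < r) 1)%N = r.
Proof. by rewrite sum1_card card_ord. Qed.

Lemma sigdimS (m N : nat) :
  (1 + \sum_(k < sigdim m N) m)%N = sigdim m N.+1.
Proof.
rewrite sum_nat_const card_ord /sigdim big_ord_recl expn0 big_distrl /=.
by congr (1 + _)%N; apply: eq_bigr => k _; rewrite -expnSr.
Qed.

Lemma leq_sigdim (m N : nat) : (sigdim m N <= sigdim m N.+1)%N.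
Proof. by rewrite {2}/sigdim big_ord_recr leq_addr. Qed.

Definition unitvec (R : realType) {m : nat} (i : 'I_m) : 'cV[R]_m :=
  delta_mx i 0.

Definition Atilde (R : realType) {m : nat} (N : nat) (i : 'I_m) :
    'M[R]_(sigdim m N.+1, sigdim m N) :=
  castmx (sigdimS m N, sum1_ord_id (sigdim m N))
    (col_mx (0 : 'M[R]_(1, _)) (blkdiag (fun _ : 'I_(sigdim m N) => unitvec R i))).

Definition A_mx (R : realType) {m : nat} (N : nat) (i : 'I_m) :
    'M[R]_(sigdim m N.+1) :=
  castmx (erefl, subnKC (leq_sigdim m N))
    (row_mx (Atilde R N i)
       (0 : 'M[R]_(sigdim m N.+1, sigdim m N.+1 - sigdim m N))).

(* The first unit vector; [sigdim m N.+1] is positive but not syntactically a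
   successor, whence the comparison in nat. *)
Definition first_unitvec (R : realType) (m N : nat) : 'cV[R]_(sigdim m N.+1) :=
  \col_j (nat_of_ord j == 0%N)%:R.

(* Main.v *)
Require Import Defs.
From HB Require Import structures.
From mathcomp Require Import all_boot all_order all_algebra.
From mathcomp Require Import all_classical all_reals all_analysis.
From mathcomp Require Import mxtens lra ring.
Set Implicit Arguments.
Unset Strict Implicit.
Unset Printing Implicit Defensive.
Import Order.TTheory GRing.Theory Num.Theory.
Import numFieldNormedType.Exports.
Local Open Scope classical_set_scope.
Local Open Scope ring_scope.

(** The index of an entry of the signature is a word over the letters of the
    path. A nonempty word is u l, a word u followed by a letter l, and the
    entry at u l is the integral of the entry at u against X_l. On the other
    hand A_i moves the entry at u to the position of u i
    ([A_mx_signature]). Hence the sum over i of the integrals of A_i S dX_i has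
    at position u l the single nonzero term i = l, which is the entry of S at
    u l, and it vanishes at the empty word, where the first unit vector supplies
    the value 1. The positions are matched by the offset
    sigdim (k + 1) = sigdim k * m + 1 of the words of length k + 1.

    The analytic content is that all these integrals exist, as an integral that
    fails to exist has the junk value 0. A continuous path of bounded variation
    has uniformly continuous coordinates, with increments dominated by those of
    its variation function ([bounded_variation_controls]). A uniformly
    continuous function is integrable against such an integrator
    ([unif_cont_integrable]), and as the integrator is itself continuous, the
    indefinite integral is again uniformly continuous and bounded if the
    integrand is ([indefinite_unif_cont],
    [indefinite_bounded]), so that the iterated integrals exist by induction on
    the length of the word ([iterated_integral_regular]).

    Everything about Riemann-Stieltjes sums follows from one estimate,
    [rssum_dist]. Two sums over different partitions are both expanded over the
    intersections of their intervals; the increment of g over the intersection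
    of [x, x'] and [y, y'] is the mixed second difference of g(min(u, v)) as u
    runs from x to x' and v from y to y'. It telescopes in either variable, so
    no common refinement is needed. *)

(** * Partitions *)

Section Partitions.
Variable R : realType.
Implicit Types (a b c x y : R) (s : seq R) (xi : nat -> R).

Lemma node_ge_size a s j : (size s <= j)%N -> node a s j = last a s.
Proof.
rewrite /node leq_eqVlt => /predU1P[<-|sj]; last by rewrite nth_default.
by rewrite (nth_last _ (a :: s)).
Qed.

Lemma node_size a b s : itv_partition a b s -> node a s (size s) = b.
Proof. exact: itv_partition_nth_size. Qed.

Lemma node_homo a b s i j :
  itv_partition a b s -> (i <= j)%N -> node a s i <= node a s j.
Proof.
move=> [/(pathP (last a s)) ps _].
have incr k : node a s k <= node a s k.+1.
  have [/ps/ltW//|sk] := ltnP k (size s).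
  by rewrite !node_ge_size // (leq_trans sk).
by apply: (@homo_leq _ _ (fun x y : R => x <= y)) => //; exact: le_trans.
Qed.

Lemma node_itv a b s j : itv_partition a b s -> a <= node a s j <= b.
Proof.
move=> ps; apply/andP; split; first exact: (node_homo ps (leq0n j)).
have [js|sj] := leqP j (size s).
  by rewrite -(node_size ps); exact: (node_homo ps js).
by rewrite node_ge_size 1?ltnW //; case: ps => _ /eqP ->.
Qed.

Lemma node_rcons a s y j : (j <= size s)%N ->
  node a (rcons s y) j = node a s j.
Proof.
move=> js; rewrite /node -rcons_cons nth_rcons /= ltnS js.
exact: set_nth_default.
Qed.

Lemma node_rcons_size a s y : node a (rcons s y) (size s).+1 = y.
Proof. by rewrite /node -rcons_cons nth_rcons /= ltnn eqxx. Qed.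

Lemma itv_partition_rcons a x y s : itv_partition a x s -> x < y ->
  itv_partition a y (rcons s y).
Proof.
by move=> ps xy; rewrite -cats1; apply: (itv_partition_cat ps);
  exact: itv_partition1.
Qed.

Lemma exists_fine_partition a b d : a <= b -> 0 < d ->
  exists2 s, itv_partition a b s & finer_than d a s.
Proof.
move=> ab d0; have [n] : exists n : nat, b - a < d / 2 * n.+1%:R.
  exists (Num.truncn ((b - a) / (d / 2))).
  by rewrite mulrC -ltr_pdivrMr ?divr_gt0 // truncnS_gt.
elim: n a ab => [|n IH] a ab.
  move=> bad; have [ab'|ba|abe] := ltgtP a b.
  - exists [:: b]; first exact: itv_partition1.
    by case=> // _; rewrite /node /=; lra.
  - by move: ab; rewrite leNgt ba.
  - by exists [::] => //; split=> //=; rewrite abe.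
rewrite -(natr1 n.+1) mulrDr mulr1 => bad.
have [abd|abd] := ltP b (a + d / 2).
  apply: IH => //; rewrite -(natr1 n) mulrDr mulr1.
  have : 0 <= d / 2 * n%:R by rewrite mulr_ge0 ?divr_ge0 // ltW.
  lra.
have [|s [ps ls] fs] := IH (a + d / 2) abd; first by lra.
exists (a + d / 2 :: s); first by split=> //=; rewrite ps andbT; lra.
case=> [_|j]; first by rewrite /node /=; lra.
exact: fs.
Qed.

End Partitions.

(** * Riemann-Stieltjes sums of scalar functions *)

Section ScalarSums.
Variable R : realType.
Implicit Types (a b c x y : R) (s : seq R) (xi : nat -> R) (f g V : R -> R).

(** Riemann-Stieltjes sums and integrals of scalar functions: [RS_sum] and
    [is_RS_integral] for the multiplication of [R], with the sums typed in the
    field [R] itself rather than in a normed module. *)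
Definition rssum f g a s xi : R :=
  \sum_(0 <= j < size s) f (xi j) * (g (node a s j.+1) - g (node a s j)).

Definition is_rsint f g a b (l : R) :=
  forall eps, 0 < eps -> exists2 d, 0 < d &
    forall s xi, tagged_partition a b s xi -> finer_than d a s ->
      `|rssum f g a s xi - l| < eps.

(** [V] dominates the increments of [g] on [a, b]; the variation function of a
    function of bounded variation is the basic example. *)
Definition controls a b V g :=
  forall x y, a <= x -> x <= y -> y <= b -> `|g y - g x| <= V y - V x.

(** The increment of [h] over the intersection of [x, x'] and [y, y'] (0 if the
    intersection is empty, see [cap_incrE]), written as a mixed difference so
    that it telescopes in each of the two intervals. *)
Definition cap_incr (h : R -> R) x x' y y' : R :=
  (h (Num.min x' y') - h (Num.min x' y)) - (h (Num.min x y') - h (Num.min x y)).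

Lemma cap_incrE h x x' y y' : x <= x' -> y <= y' ->
  cap_incr h x x' y y' =
    if (x <= y') && (y <= x') then h (Num.min x' y') - h (Num.max x y) else 0.
Proof.
move=> xx' yy'; rewrite /cap_incr.
have [xy'|y'x] /= := leP x y'; last first.
  have yx := le_lt_trans yy' y'x.
  rewrite (min_r (le_trans (ltW y'x) xx')) (min_r (le_trans (ltW yx) xx')).
  by rewrite (min_r (ltW yx)) subrr.
have [yx'|x'y] := leP y x'; last first.
  have x'y' := lt_le_trans x'y yy'.
  by rewrite (min_l (ltW x'y')) (min_l (le_trans xx' (ltW x'y))) !subrr.
by case: (leP x y) => _; ring.
Qed.

Lemma cap_incr_sum h a b s x x' : itv_partition a b s -> a <= x -> x <= b ->
  a <= x' -> x' <= b ->
  \sum_(0 <= k < size s) cap_incr h x x' (node a s k) (node a s k.+1) =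
    h x' - h x.
Proof.
move=> ps ax xb ax' x'b.
rewrite /cap_incr sumrB !(telescope_sumr (fun k => h (Num.min _ (node a s k)))) //.
rewrite (node_size ps) (_ : node a s 0 = a) //.
by rewrite (min_l x'b) (min_l xb) (min_r ax') (min_r ax); ring.
Qed.

Lemma cap_incrC h x x' y y' : cap_incr h x x' y y' = cap_incr h y y' x x'.
Proof. by rewrite /cap_incr !(minC x) !(minC x'); ring. Qed.

Lemma cap_incr_le a b V g x x' y y' : controls a b V g ->
  a <= x -> x <= x' -> x' <= b -> a <= y -> y <= y' -> y' <= b ->
  `|cap_incr g x x' y y'| <= cap_incr V x x' y y'.
Proof.
move=> gV ax xx' x'b ay yy' y'b; rewrite !cap_incrE //.
case: ifPn => [/andP[xy' yx']|_]; last by rewrite normr0.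
by apply: gV; rewrite ?le_max ?ax // ?le_min ?ge_max ?ge_min ?x'b // xx' yx' xy'.
Qed.

(** The integrands have to be close only at tags of intervals that meet. Taking
    f' = f gives the Cauchy criterion, taking f' = 0 bounds the sums of f. *)
Lemma rssum_dist a b V g f f' s xi s' xi' e :
  controls a b V g -> tagged_partition a b s xi -> tagged_partition a b s' xi' ->
  (forall j k, (j < size s)%N -> (k < size s')%N ->
     node a s j <= node a s' k.+1 -> node a s' k <= node a s j.+1 ->
     `|f (xi j) - f' (xi' k)| <= e) ->
  `|rssum f g a s xi - rssum f' g a s' xi'| <= e * (V b - V a).
Proof.
move=> gV [ps _] [ps' _] fe.
pose D h j k := cap_incr h (node a s j) (node a s j.+1)
                           (node a s' k) (node a s' k.+1).
have sum_in h j : \sum_(0 <= k < size s') D h j k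
                  = h (node a s j.+1) - h (node a s j).
  have /andP[? ?] := node_itv j ps; have /andP[? ?] := node_itv j.+1 ps.
  exact: (cap_incr_sum _ ps').
have sum_out h k : \sum_(0 <= j < size s) D h j k
                  = h (node a s' k.+1) - h (node a s' k).
  have /andP[? ?] := node_itv k ps'; have /andP[? ?] := node_itv k.+1 ps'.
  under eq_bigr do rewrite /D cap_incrC.
  exact: (cap_incr_sum _ ps).
have -> : rssum f g a s xi = \sum_(0 <= j < size s)
    \sum_(0 <= k < size s') f (xi j) * D g j k.
  by apply: eq_bigr => j _; rewrite -mulr_sumr sum_in.
have -> : rssum f' g a s' xi' = \sum_(0 <= j < size s)
    \sum_(0 <= k < size s') f' (xi' k) * D g j k.
  by rewrite exchange_big; apply: eq_bigr => k _; rewrite -mulr_sumr sum_out.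
have -> : V b - V a = \sum_(0 <= j < size s) \sum_(0 <= k < size s') D V j k.
  under eq_bigr do rewrite sum_in.
  by rewrite (telescope_sumr (fun j => V (node a s j))) // (node_size ps).
rewrite -sumrB mulr_sumr; apply: (le_trans (ler_norm_sum _ _ _)).
apply: ler_sum_nat => j /andP[_ js].
rewrite -sumrB mulr_sumr; apply: (le_trans (ler_norm_sum _ _ _)).
apply: ler_sum_nat => k /andP[_ ks].
have /andP[aj _] := node_itv j ps; have /andP[_ jb] := node_itv j.+1 ps.
have /andP[ak _] := node_itv k ps'; have /andP[_ kb] := node_itv k.+1 ps'.
have jj := node_homo ps (leqnSn j); have kk := node_homo ps' (leqnSn k).
have DV : `|D g j k| <= D V j k by exact: (cap_incr_le gV).
rewrite -mulrBl normrM.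
case: (boolP ((node a s j <= node a s' k.+1) && (node a s' k <= node a s j.+1))).
  move=> /andP[jk kj]; apply: ler_pM => //; exact: fe.
by move=> /negbTE nov; rewrite /D !cap_incrE // nov normr0 !mulr0.
Qed.

(** A modulus of continuity: [f] varies by at most [e] over distances below
    [d] within [a, b]. *)
Definition modulus a b f (d e : R) :=
  forall x y, a <= x -> x <= b -> a <= y -> y <= b -> `|x - y| < d ->
    `|f x - f y| <= e.

(** Uniform continuity on [a, b]. *)
Definition unif_cont a b f :=
  forall e, 0 < e -> exists2 d, 0 < d & modulus a b f d e.

Definition bounded_on a b f := exists B, forall x, a <= x -> x <= b -> `|f x| <= B.

Lemma modulusS a b c f d e : c <= b -> modulus a b f d e -> modulus a c f d e.
Proof.
by move=> cb m x y ax xc ay yc; apply: m => //; apply: le_trans cb.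
Qed.

Lemma controlsS a b c V g : c <= b -> controls a b V g -> controls a c V g.
Proof. by move=> cb m x y ax xy yc; apply: m => //; apply: le_trans cb. Qed.

Lemma controls_le a b V g x y : controls a b V g -> a <= x -> x <= y -> y <= b ->
  V x <= V y.
Proof.
by move=> gV ax xy yb; rewrite -subr_ge0 (le_trans _ (gV x y _ _ _)).
Qed.

Lemma tag_itv a b s xi j : tagged_partition a b s xi -> (j < size s)%N ->
  a <= xi j <= b.
Proof.
move=> [ps tp] js; have /andP[jx xj] := tp _ js.
have /andP[aj _] := node_itv j ps; have /andP[_ jb] := node_itv j.+1 ps.
by rewrite (le_trans aj jx) (le_trans xj jb).
Qed.

Lemma left_tagged a b s : itv_partition a b s -> tagged_partition a b s (node a s).
Proof.
by move=> ps; split=> // j js; rewrite lexx (node_homo ps (leqnSn j)).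
Qed.

Lemma exists_fine_tagged a b d : a <= b -> 0 < d ->
  exists2 s, tagged_partition a b s (node a s) & finer_than d a s.
Proof.
move=> ab d0; have [s ps fs] := exists_fine_partition ab d0.
by exists s => //; exact: left_tagged.
Qed.

Lemma rssum_cauchy a b V g f d e s xi s' xi' :
  controls a b V g -> modulus a b f d e ->
  tagged_partition a b s xi -> tagged_partition a b s' xi' ->
  finer_than (d / 2) a s -> finer_than (d / 2) a s' ->
  `|rssum f g a s xi - rssum f g a s' xi'| <= e * (V b - V a).
Proof.
move=> gV fm ts ts' fs fs'; apply: (rssum_dist gV ts ts') => j k js ks jk kj.
have /andP[? ?] := tag_itv ts js; have /andP[? ?] := tag_itv ts' ks.
apply: fm => //; have := fs _ js; have := fs' _ ks.
have /andP[? ?] := ts.2 _ js; have /andP[? ?] := ts'.2 _ ks.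
by rewrite ltr_norml; move=> ? ?; apply/andP; split; lra.
Qed.

Lemma rssum_bound a b V g f B s xi :
  controls a b V g -> (forall x, a <= x -> x <= b -> `|f x| <= B) ->
  tagged_partition a b s xi ->
  `|rssum f g a s xi| <= B * (V b - V a).
Proof.
move=> gV fB ts; have := @rssum_dist a b V g f (fun=> 0) s xi s xi B gV ts ts.
rewrite [X in _ - X](_ : _ = 0) ?subr0; last first.
  by apply: big1 => j _; rewrite mul0r.
apply=> j k js ks _ _; rewrite subr0.
by have /andP[? ?] := tag_itv ts js; exact: fB.
Qed.

Lemma rssum_rcons a s y f g xi :
  rssum f g a (rcons s y) xi =
  rssum f g a s xi + f (xi (size s)) * (g y - g (node a s (size s))).
Proof.
rewrite /rssum size_rcons big_nat_recr //= node_rcons_size node_rcons //.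
congr (_ + _); rewrite !big_nat; apply: eq_bigr => j /andP[_ js].
by rewrite !node_rcons // ltnW.
Qed.

Lemma RS_integral_unique (U : Type) (Z : zmodType) (W : normedModType R)
    (op : U -> Z -> W) (f : R -> U) (g : R -> Z) a b l l' : a <= b ->
  is_RS_integral op f g a b l -> is_RS_integral op f g a b l' -> l = l'.
Proof.
move=> ab il il'; apply/eqP; rewrite -subr_eq0 -normr_le0 leNgt; apply/negP => ll'.
have e0 : 0 < `|l - l'| / 2 by rewrite divr_gt0.
have [d d0 dl] := il _ e0; have [d' d'0 dl'] := il' _ e0.
have [|s ts fs] := @exists_fine_tagged a b (Num.min d d') ab.
  by rewrite lt_min d0.
have h : `|RS_sum op f g a s (node a s) - l| < `|l - l'| / 2.
  by apply: dl => // j /fs /lt_le_trans -> //; rewrite ge_min lexx.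
have h' : `|RS_sum op f g a s (node a s) - l'| < `|l - l'| / 2.
  by apply: dl' => // j /fs /lt_le_trans -> //; rewrite ge_min lexx orbT.
have := ler_distD (RS_sum op f g a s (node a s)) l l'.
by rewrite distrC in h; lra.
Qed.

Lemma RS_integralE (U : Type) (Z : zmodType) (W : normedModType R)
    (op : U -> Z -> W) (f : R -> U) (g : R -> Z) a b l : a <= b ->
  is_RS_integral op f g a b l -> RS_integral op f g a b = l.
Proof.
by move=> ab il; apply: xget_unique => // l' il'; exact: RS_integral_unique il' il.
Qed.

(** Existence of the integral of a uniformly continuous function. *)
Lemma unif_cont_integrable a b V f g : a <= b -> controls a b V g ->
  unif_cont a b f -> exists l, is_rsint f g a b l.
Proof.
move=> ab gV fc; have Vab : 0 <= V b - V a by rewrite subr_ge0 (controls_le gV).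
have cauchy eps : 0 < eps -> exists2 d, 0 < d & forall s xi s' xi',
    tagged_partition a b s xi -> tagged_partition a b s' xi' ->
    finer_than d a s -> finer_than d a s' ->
    `|rssum f g a s xi - rssum f g a s' xi'| <= eps.
  move=> eps0; have c0 : 0 < V b - V a + 1 by lra.
  have [d d0 fm] := fc (eps / (V b - V a + 1)) (divr_gt0 eps0 c0).
  exists (d / 2); first by rewrite divr_gt0.
  move=> s xi s' xi' ts ts' fs fs'.
  apply: (le_trans (rssum_cauchy gV fm ts ts' fs fs')).
  by rewrite mulrAC ler_pdivrMr // ler_pM2l //; lra.
(* the integral is the limit inferior of the sums as the mesh tends to 0 *)
pose E := [set x | exists2 d, 0 < d & forall s xi,
  tagged_partition a b s xi -> finer_than d a s -> x <= rssum f g a s xi].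
exists (sup E) => eps eps0.
have e20 : 0 < eps / 2 by rewrite divr_gt0.
have [d d0 close] := cauchy _ e20; exists d => // s xi ts fs.
have inE' : E (rssum f g a s xi - eps / 2).
  exists d => // s' xi' ts' fs'.
  by have := close _ _ _ _ ts ts' fs fs'; rewrite ler_norml => /andP[? ?]; lra.
have ubE : ubound E (rssum f g a s xi + eps / 2).
  move=> x [d' d'0 xS].
  have [|s' ts' fs'] := @exists_fine_tagged a b (Num.min d d') ab.
    by rewrite lt_min d0.
  apply: (le_trans (xS s' (node a s') ts' _)).
    by move=> j /fs' /lt_le_trans -> //; rewrite ge_min lexx orbT.
  have fs'd : finer_than d a s'.
    by move=> j /fs' /lt_le_trans -> //; rewrite ge_min lexx.
  by have := close _ _ _ _ ts ts' fs fs'd; rewrite ler_norml => /andP[? ?]; lra.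
have lo : rssum f g a s xi - eps / 2 <= sup E.
  by apply: ub_le_sup => //; exists (rssum f g a s xi + eps / 2).
have hi : sup E <= rssum f g a s xi + eps / 2.
  by apply: ge_sup => //; exists (rssum f g a s xi - eps / 2).
by rewrite ltr_norml; apply/andP; split; lra.
Qed.

(** The mesh needed for a given precision depends only on the modulus of
    continuity of the integrand, hence works for the integrals over all
    subintervals at once. This uniformity makes the indefinite integral uniformly
    continuous. *)
Lemma is_rsint_approx a b V f g d e l s xi : a <= b -> 0 < d ->
  controls a b V g -> modulus a b f d e -> is_rsint f g a b l ->
  tagged_partition a b s xi -> finer_than (d / 2) a s ->
  `|rssum f g a s xi - l| <= e * (V b - V a).
Proof.
move=> ab d0 gV fm il ts fs; apply/ler_addgt0Pr => eta eta0.
have [d' d'0 close] := il _ eta0.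
have [|s' ts' fs'] := @exists_fine_tagged a b (Num.min (d / 2) d') ab.
  by rewrite lt_min divr_gt0.
have Sl : `|rssum f g a s' (node a s') - l| < eta.
  by apply: close => // j /fs' /lt_le_trans -> //; rewrite ge_min lexx orbT.
have SS : `|rssum f g a s xi - rssum f g a s' (node a s')| <= e * (V b - V a).
  apply: (rssum_cauchy gV fm) => // j /fs' /lt_le_trans -> //.
  by rewrite ge_min lexx.
apply: (le_trans (ler_distD (rssum f g a s' (node a s')) _ _)).
exact: lerD SS (ltW Sl).
Qed.

Lemma is_rsint_bound a b V f g B l : a <= b -> controls a b V g ->
  (forall x, a <= x -> x <= b -> `|f x| <= B) -> is_rsint f g a b l ->
  `|l| <= B * (V b - V a).
Proof.
move=> ab gV fB il; apply/ler_addgt0Pr => eta eta0.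
have [d d0 close] := il _ eta0.
have [s ts fs] := exists_fine_tagged ab d0.
rewrite -(subrK (rssum f g a s (node a s)) l) addrC.
apply: (le_trans (ler_normD _ _)); apply: lerD.
  exact: (rssum_bound gV fB ts).
by rewrite distrC ltW // close.
Qed.

Lemma indefinite_bounded a b V f g F : a <= b -> controls a b V g ->
  bounded_on a b f ->
  (forall t, a <= t -> t <= b -> is_rsint f g a t (F t)) ->
  bounded_on a b F.
Proof.
move=> ab gV [B fB] iF; exists (B * (V b - V a)) => t at_ tb.
have B0 : 0 <= B by rewrite (le_trans (normr_ge0 (f a))) // fB.
have fBt x : a <= x -> x <= t -> `|f x| <= B.
  by move=> ax xt; rewrite fB // (le_trans xt).
apply: (le_trans (is_rsint_bound at_ (controlsS tb gV) fBt (iF t at_ tb))).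
by apply: ler_wpM2l => //; rewrite lerD2r (controls_le gV).
Qed.

(** For s < t close to each other, a fine partition of [a, s] followed by the
    single interval [s, t] is a fine partition of [a, t], so the integral over
    [a, t] differs little from the integral over [a, s] plus a multiple of
    g(t) - g(s). *)
Lemma indefinite_unif_cont a b V f g F : a <= b -> controls a b V g ->
  unif_cont a b f -> bounded_on a b f -> unif_cont a b g ->
  (forall t, a <= t -> t <= b -> is_rsint f g a t (F t)) ->
  unif_cont a b F.
Proof.
move=> ab gV fc [B fB] gc iF eps eps0.
have B0 : 0 <= B by rewrite (le_trans (normr_ge0 (f a))) // fB.
have Vab : 0 <= V b - V a by rewrite subr_ge0 (controls_le gV).
(* a quarter of [eps] for each of the two sums, and half of it for the
   increment of the integrator *)
have c0 : 0 < 4 * (V b - V a + 1) by lra.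
have [d d0 fm] := fc _ (divr_gt0 eps0 c0).
have c'0 : 0 < 2 * (B + 1) by lra.
have [d' d'0 gm] := gc _ (divr_gt0 eps0 c'0).
exists (Num.min (d / 2) d'); first by rewrite lt_min divr_gt0.
suff main x y : a <= x -> x < y -> y <= b -> y - x < d / 2 -> y - x < d' ->
    `|F y - F x| <= eps.
  move=> x y ax xb ay yb; rewrite lt_min => /andP[xyd xyd'].
  have [xy|yx|<-] := ltgtP x y; last by rewrite subrr normr0 ltW.
  - rewrite distrC; rewrite ltr0_norm ?opprB ?subr_lt0 // in xyd xyd'.
    exact: main.
  - by rewrite gtr0_norm ?subr_gt0 // in xyd xyd'; exact: main.
move=> ax xy yb yxd yxd'.
have ay : a <= y by rewrite (le_trans ax) // ltW.
have xb : x <= b by rewrite (le_trans (ltW xy)).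
have d20 : 0 < d / 2 by rewrite divr_gt0.
have [s ps fs] := exists_fine_partition ax d20.
pose xi := node a (rcons s y).
have ts : tagged_partition a x s xi.
  split=> // j js; rewrite /xi node_rcons ?lexx 1?ltnW //=.
  exact: (node_homo ps).
have ts' : tagged_partition a y (rcons s y) xi.
  exact/left_tagged/(itv_partition_rcons ps).
have fs' : finer_than (d / 2) a (rcons s y).
  move=> j; rewrite size_rcons ltnS leq_eqVlt => /predU1P[->|js].
    by rewrite node_rcons_size node_rcons // (node_size ps).
  by rewrite !node_rcons // ?(ltnW js) //; exact: fs.
have bound z : a <= z -> z <= b ->
    eps / (4 * (V b - V a + 1)) * (V z - V a) <= eps / 4.
  move=> az zb; have Vzb := controls_le gV az zb (lexx b).
  rewrite mulrAC ler_pdivrMr // mulrCA mulrA.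
  by rewrite (_ : 4 * (eps / 4) = eps) ?ler_pM2l //; [lra|field].
have Hx := le_trans (is_rsint_approx ax d0 (controlsS xb gV)
  (modulusS xb fm) (iF x ax xb) ts fs) (bound x ax xb).
have Hy := le_trans (is_rsint_approx ay d0 (controlsS yb gV)
  (modulusS yb fm) (iF y ay yb) ts' fs') (bound y ay yb).
have xis : xi (size s) = x by rewrite /xi node_rcons // (node_size ps).
rewrite rssum_rcons xis (node_size ps) in Hy.
have Hg : `|f x * (g y - g x)| <= eps / 2.
  have Hgy : `|g y - g x| <= eps / (2 * (B + 1)).
    by apply: gm => //; rewrite gtr0_norm // subr_gt0.
  rewrite normrM; apply: (le_trans (ler_pM _ _ (fB x ax xb) Hgy)) => //.
  rewrite mulrCA ler_pM2l //; rewrite mulrC ler_pdivrMl //; lra.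
move: Hx Hy Hg; set S := rssum _ _ _ _ _; set p := f x * _.
rewrite !ler_norml => /andP[? ?] /andP[? ?] /andP[? ?].
by apply/andP; split; lra.
Qed.

End ScalarSums.

(** * Vector valued paths and integrals *)

(** The Heine-Cantor theorem on a segment. *)
Lemma within_continuous_uniformly (R : realType) (W : normedModType R) (a b : R)
    (f : R -> W) : {within `[a, b], continuous f} ->
  forall eps, 0 < eps -> exists2 d, 0 < d & forall x y,
    a <= x -> x <= b -> a <= y -> y <= b -> `|x - y| < d -> `|f x - f y| <= eps.
Proof.
move=> fc eps eps0.
have e20 : 0 < eps / 2 by rewrite divr_gt0.
have := @segment_compact R a b; rewrite compact_near_coveringP => cov.
pose P (d x : R) := x \in `[a, b] -> forall y, y \in `[a, b] ->
  `|x - y| < d -> `|f x - f y| <= eps.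
have cP : \forall d \near 0^'+, `[a, b] `<=` P d.
  apply: cov => x xab.
  have /subspace_continuousP/(_ _ xab)/cvgrPdist_lt/(_ _ e20) := fc.
  move=> /nbhs_ballP[r /= r0 rP].
  have r20 : 0 < r / 2 by rewrite divr_gt0.
  have fr y : y \in `[a, b] -> `|x - y| < r -> `|f x - f y| < eps / 2.
    by move=> yab xy; apply: rP.
  exists (ball x (r / 2), [set d | d < r / 2]).
    split; first exact: nbhsx_ballx.
    exact: nbhs_right_lt.
  move=> [x' d] [/= xx' dr] x'ab y yab x'y.
  have xx'r : `|x - x'| < r by have : `|x - x'| < r / 2 := xx'; lra.
  have xyr : `|x - y| < r.
    apply: (le_lt_trans (ler_distD x' _ _)).
    by have : `|x - x'| < r / 2 := xx'; lra.
  apply: (le_trans (ler_distD (f x) _ _)).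
  by rewrite (distrC _ (f x)); have := fr _ x'ab xx'r; have := fr _ yab xyr; lra.
have : \forall d \near 0^'+, 0 < d /\ `[a, b] `<=` P d.
  near=> d; split; first by near: d; exact: nbhs_right_gt.
  by near: d.
move=> /filter_ex [d [d0 dP]]; exists d => // x y ax xb ay yb.
have xab : x \in `[a, b] by rewrite in_itv /= ax.
by apply: (dP x) => //; rewrite in_itv /= ay.
Unshelve. all: by end_near. Qed.

Lemma cV_norm_lt (R : realType) p (v : 'cV[R]_p) e :
  0 < e -> (forall r, `|v r 0| < e) -> `|v| < e.
Proof.
move=> e0 ve; rewrite [ltLHS](mx_normrE v : `|v| = _).
by apply: bigmax_lt => // -[r c] _ /=; rewrite (ord1 c).
Qed.

Lemma norm_entry_le (R : realType) m (v : 'cV[R]_m) i : `|v i 0| <= `|v|.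
Proof.
rewrite [leRHS](mx_normrE v : `|v| = _).
exact: (le_bigmax 0 (fun ij : 'I_m * 'I_1 => `|v ij.1 ij.2|) (i, 0)).
Qed.

Lemma entry_unif_cont (R : realType) m (X : R -> 'cV[R]_m) a b i :
  {within `[a, b], continuous X} -> unif_cont a b (fun x => X x i 0).
Proof.
move=> /within_continuous_uniformly Xc eps /Xc[d d0 dX]; exists d => //.
move=> x y ax xb ay yb xy; apply: (le_trans _ (dX x y ax xb ay yb xy)).
by apply: (le_trans _ (norm_entry_le _ i)); rewrite !mxE.
Qed.

(** The variation of the path over [a, x], as a function of x, dominates its
    increments. *)
Lemma bounded_variation_controls (R : realType) (W : normedModType R)
    (X : R -> W) a b : bounded_variation_path a b X ->
  exists V : R -> R, forall x y, a <= x -> x <= y -> y <= b ->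
    `|X y - X x| <= V y - V x.
Proof.
move=> [M XM].
pose var s := \sum_(0 <= j < size s) `|X (node a s j.+1) - X (node a s j)|.
have var_rcons s x y : itv_partition a x s ->
    var (rcons s y) = var s + `|X y - X x|.
  move=> ps; rewrite /var size_rcons big_nat_recr //= node_rcons_size.
  rewrite node_rcons // (node_size ps); congr (_ + _).
  rewrite !big_nat; apply: eq_bigr => j /andP[_ js].
  by rewrite !node_rcons // ltnW.
pose S x := [set var s | s in itv_partition a x].
(* a partition of [a, x] extends to one of [a, b] *)
have bounded x : x <= b -> has_ubound (S x).
  move=> xb; exists M => _ [s ps <-].
  have [xb'|bx|xbe] := ltgtP x b; last by apply: XM; exists s => //; rewrite -xbe.
  - have := var_rcons s x b ps; have : var (rcons s b) <= M.
      by apply: XM; exists (rcons s b) => //; exact: itv_partition_rcons ps _.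
    by have := normr_ge0 (X b - X x); lra.
  - by move: xb; rewrite leNgt bx.
exists (fun x => sup (S x)) => x y ax xy yb.
have [->|xy'] := eqVneq x y; first by rewrite !subrr normr0.
have {}xy : x < y by rewrite lt_neqAle xy' xy.
rewrite lerBrDr addrC -lerBrDr; apply: ge_sup.
  have [s ps _] := exists_fine_partition ax (@ltr01 R).
  by exists (var s); exists s.
move=> _ [s ps <-]; rewrite lerBrDr -(var_rcons _ _ _ ps).
apply: ub_le_sup; first exact: bounded.
by exists (rcons s y) => //; exact: itv_partition_rcons ps xy.
Qed.

(** A vector valued integral may be computed entry by entry, when every entry of
    the product is a product of two scalars. *)
Lemma is_RS_integral_entries (R : realType) p (U : Type) (Z : zmodType)
    (op : U -> Z -> 'cV[R]_p) (F : R -> U) (G : R -> Z)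
    (f g : 'I_p -> R -> R) a b (l : 'cV[R]_p) :
  (forall r x y z, op (F x) (G y - G z) r 0 = f r x * (g r y - g r z)) ->
  (forall r, is_rsint (f r) (g r) a b (l r 0)) ->
  is_RS_integral op F G a b l.
Proof.
move=> opE il eps eps0.
have /choice[d dP] : forall r, exists d, 0 < d /\
    forall s xi, tagged_partition a b s xi -> finer_than d a s ->
      `|rssum (f r) (g r) a s xi - l r 0| < eps.
  by move=> r; have [d] := il r _ eps0; exists d.
exists (\big[Num.min/1]_r d r).
  by apply: lt_bigmin => // r _; case: (dP r).
move=> s xi ts fs; apply: cV_norm_lt => // r; rewrite !mxE summxE.
under eq_bigr do rewrite opE.
apply: (dP r).2 => // j /fs /lt_le_trans -> //.
exact: bigmin_le.
Qed.

Lemma is_rsint_unique (R : realType) (a b : R) f g l l' : a <= b ->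
  is_rsint f g a b l -> is_rsint f g a b l' -> l = l'.
Proof. exact: (@RS_integral_unique R R R R *%R). Qed.

Lemma RS_integral_entries (R : realType) p (U : Type) (Z : zmodType)
    (op : U -> Z -> 'cV[R]_p) (F : R -> U) (G : R -> Z)
    (f g : 'I_p -> R -> R) a b V : a <= b ->
  (forall r x y z, op (F x) (G y - G z) r 0 = f r x * (g r y - g r z)) ->
  (forall r, unif_cont a b (f r)) -> (forall r, controls a b V (g r)) ->
  RS_integrable op F G a b /\
  forall r, is_rsint (f r) (g r) a b (RS_integral op F G a b r 0).
Proof.
move=> ab opE fc gV.
have /choice[l il] : forall r, exists l, is_rsint (f r) (g r) a b l.
  by move=> r; exact: unif_cont_integrable ab (gV r) (fc r).
have iL : is_RS_integral op F G a b (\col_r l r).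
  by apply: (is_RS_integral_entries opE) => r; rewrite mxE.
split; first by exists (\col_r l r).
by move=> r; rewrite (RS_integralE ab iL) mxE.
Qed.

Lemma unif_contS (R : realType) (a b c : R) f :
  c <= b -> unif_cont a b f -> unif_cont a c f.
Proof.
by move=> cb fc e /fc[d d0 fd]; exists d => //; exact: modulusS fd.
Qed.

Lemma unif_cont_cst (R : realType) (a b c : R) : unif_cont a b (fun=> c).
Proof. by move=> e e0; exists 1 => // x y *; rewrite subrr normr0 ltW. Qed.

(** * Iterated integrals *)

Section IteratedIntegrals.
Variables (R : realType) (m : nat) (X : R -> 'cV[R]_m) (a b : R) (V : R -> R).
Hypothesis XV : forall i, controls a b V (fun x => X x i 0).
Hypothesis Xc : forall i, unif_cont a b (fun x => X x i 0).

(** The entry at the word q j is the integral of the entry at q against the j-th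
    coordinate. *)
Lemma iterated_integral_step k (q : 'I_(m ^ k)) (j : 'I_m) (r : 'I_(m ^ k.+1)) t :
  (forall i, unif_cont a b (fun s => iterated_integral X a k s i 0)) ->
  a <= t -> t <= b -> r = (q * m + j)%N :> nat ->
  is_rsint (fun s => iterated_integral X a k s q 0) (fun s => X s j 0) a t
    (iterated_integral X a k.+1 t r 0).
Proof.
move=> Ic at_ tb rE; rewrite /= castmxE.
set r' := cast_ord _ r; rewrite (ord1 (cast_ord _ _)).
have rqj : r' = mxtens_index (q, j) by apply: val_inj; rewrite /= rE.
have [_ /(_ r')] := @RS_integral_entries R (m ^ k * m) _ _ kron
  (iterated_integral X a k) X
  (fun r x => iterated_integral X a k x (mxtens_unindex r).1 0)
  (fun r x => X x (mxtens_unindex r).2 0) a t V at_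
  (ltac:(by move=> r0 x y z; rewrite /kron !mxE !(ord1 (mxtens_unindex _).1)
     !(ord1 (mxtens_unindex _).2)))
  (fun r => unif_contS tb (Ic _)) (fun r => controlsS tb (XV _)).
by rewrite rqj mxtens_indexK.
Qed.

Lemma split_word_index k (r : 'I_(m ^ k.+1)) :
  exists (q : 'I_(m ^ k)) (j : 'I_m), r = (q * m + j)%N :> nat.
Proof.
have e : (m ^ k.+1 = m ^ k * m)%N by rewrite expnSr.
exists (mxtens_unindex (cast_ord e r)).1, (mxtens_unindex (cast_ord e r)).2.
have /(congr1 val) := mxtens_unindexK (cast_ord e r).
by case: (mxtens_unindex _).
Qed.

Hypothesis ab : a <= b.

(** Uniform continuity and boundedness are propagated together: the continuity
    of an indefinite integral uses a bound of the integrand. *)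
Lemma iterated_integral_regular k (r : 'I_(m ^ k)) :
  unif_cont a b (fun s => iterated_integral X a k s r 0) /\
  bounded_on a b (fun s => iterated_integral X a k s r 0).
Proof.
elim: k r => [|k IH] r.
  rewrite (_ : (fun s => _) = fun=> 1).
    by split; [exact: unif_cont_cst|exists `|1|].
  by apply/funext => s; rewrite mxE.
have [q [j rE]] := split_word_index r; have [Iqc Iqb] := IH q.
have II t : a <= t -> t <= b -> is_rsint _ _ a t _ := fun at_ tb =>
  iterated_integral_step (fun i => (IH i).1) at_ tb rE.
split; first exact: indefinite_unif_cont ab (XV j) Iqc Iqb (Xc j) II.
exact: indefinite_bounded ab (XV j) Iqb II.
Qed.

End IteratedIntegrals.

(** * Entries of the signature and of the matrices A_i *)

Lemma sigdim_succ m k : sigdim m k.+1 = (sigdim m k * m).+1.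
Proof. by rewrite -sigdimS sum_nat_const card_ord. Qed.

(** The words of length [k] occupy the positions from [sigdim m k] on. *)
Lemma signature_entry (R : realType) m (X : R -> 'cV[R]_m) N a b k
    (q : 'I_(m ^ k)) (r : 'I_(sigdim m N.+1)) : (k < N.+1)%N ->
  r = (sigdim m k + q)%N :> nat ->
  signature X N a b r 0 = iterated_integral X a k b q 0.
Proof.
move=> kN rE; pose i := Ordinal kN.
have -> : r = @tagnat.Rank N.+1 (fun k => m ^ k)%N i q.
  apply: ord_inj; rewrite tagnat.RankEsum rE /sigdim.
  by rewrite (big_ord_widen N.+1 (fun k => m ^ k)%N) // ltnW.
have := mxcolK (fun k : 'I_N.+1 => iterated_integral X a k b) i.
by move=> /matrixP/(_ q 0); rewrite mxE.
Qed.

Lemma split_signature_index m N (r : 'I_(sigdim m N.+1)) :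
  exists k (q : 'I_(m ^ k)), (k < N.+1)%N /\ r = (sigdim m k + q)%N :> nat.
Proof.
exists (tagnat.sig1 r), (tagnat.sig2 r); split => //.
rewrite {1}(tagnat.rect r) /sigdim.
by rewrite (big_ord_widen N.+1 (fun k => m ^ k)%N) // ltnW.
Qed.

Lemma A_mxE (R : realType) m N (i : 'I_m) (r c : 'I_(sigdim m N.+1)) :
  A_mx R N i r c = (r == (c * m + i).+1 :> nat)%:R.
Proof.
rewrite /A_mx castmxE cast_ord_id mxE.
case: splitP => [c'|c'] /= ->; last first.
  rewrite mxE ltn_eqF //.
  have := ltn_ord r; rewrite {2}sigdim_succ ltnS => /leq_trans; apply.
  by rewrite (leq_trans _ (leq_addr _ _)) // leq_mul2r leq_addr orbT.
rewrite /Atilde castmxE mxE.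
case: splitP => [r'|r'] /= ->; first by rewrite mxE (ord1 r').
rewrite add1n eqSS mxE; set c'' := cast_ord _ _.
have block w (j : 'I_(sigdim m N)) : (\sum_(k < sigdim m N | k < j) w = j * w)%N.
  by rewrite -(big_ord_widen _ (fun=> w) (ltnW (ltn_ord j))) sum_nat_const card_ord.
(* both block indices are computed from the offsets of their blocks *)
have := tagnat.rect r'; have := tagnat.rect c''; rewrite !block.
move: (tagnat.sig1 r') (tagnat.sig1 c'') (tagnat.sig2 r') (tagnat.sig2 c'').
move=> j k x z; rewrite (ord1 z) muln1 addn0 => ck ->.
rewrite (_ : c' = k :> nat) //; case: eqVneq => [->|jk].
  by rewrite mxE andbT eqn_add2l.
rewrite mxE; case: eqP => // jxki; case/eqP: jk; apply: val_inj => /=.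
have m0 : (0 < m)%N by rewrite (leq_trans _ (ltn_ord i)).
have /(congr1 (divn^~ m)) := jxki.
by rewrite !divnMDl // !divn_small // !addn0.
Qed.

Lemma A_mx_mul_entry0 (R : realType) m N (i : 'I_m) (S : 'cV[R]_(sigdim m N.+1))
    (r : 'I_(sigdim m N.+1)) : r = 0%N :> nat -> (A_mx R N i *m S) r 0 = 0.
Proof.
by move=> r0; rewrite mxE big1 // => c _; rewrite A_mxE r0 mul0r.
Qed.

Lemma A_mx_mul_entryS (R : realType) m N (i l : 'I_m) (S : 'cV[R]_(sigdim m N.+1))
    (r c : 'I_(sigdim m N.+1)) : r = (c * m + l).+1 :> nat ->
  (A_mx R N i *m S) r 0 = (l == i)%:R * S c 0.
Proof.
move=> rE; have m0 : (0 < m)%N by rewrite (leq_trans _ (ltn_ord i)).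
rewrite mxE (bigD1 c) //= A_mxE rE eqSS eqn_add2l big1 ?addr0 // => d dc.
rewrite A_mxE rE eqSS; case: eqP => [cd|]; last by rewrite mul0r.
case/eqP: dc; apply: val_inj => /=; have /(congr1 (divn^~ m)) := cd.
by rewrite !divnMDl // !divn_small // !addn0.
Qed.

(** The matrix A_i maps the signature to the vector whose entry at a nonempty
    word is the entry of the signature at the word without its last letter if
    that letter is i, and 0 otherwise. *)
Lemma A_mx_signature (R : realType) m (X : R -> 'cV[R]_m) N a k (q : 'I_(m ^ k))
    (l i : 'I_m) (r : 'I_(sigdim m N.+1)) b : (k < N)%N ->
  r = (sigdim m k.+1 + (q * m + l))%N :> nat ->
  (A_mx R N i *m signature X N a b) r 0 =
  (l == i)%:R * iterated_integral X a k b q 0.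
Proof.
move=> kN rE.
have cN : (sigdim m k + q < sigdim m N.+1)%N.
  have -> : sigdim m N.+1 = (sigdim m k.+1 + \sum_(k.+1 <= j < N.+1) m ^ j)%N.
    rewrite /sigdim -!(big_mkord xpredT (fun j => m ^ j)%N).
    by rewrite (@big_cat_nat _ _ _ k.+1) // ltnW.
  rewrite ltn_addr // /sigdim big_ord_recr /= ltn_add2l //.
rewrite (@A_mx_mul_entryS _ _ _ i l _ r (Ordinal cN)).
  by rewrite (@signature_entry _ _ X N a b k q) // ltnW.
by rewrite rE sigdim_succ /= mulnDl addSn addnA.
Qed.

Theorem proposition2p6 (R : realType) (T : R) (hT : 0 < T) (m N : nat)
    (X : R -> 'cV[R]_m)
    (hXc : {within `[0, T], continuous X})
    (hXbv : bounded_variation_path 0 T X) :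
  forall t : R, 0 <= t <= T ->
    (forall i : 'I_m,
       RS_integrable vscale (fun s => A_mx R N i *m signature X N 0 s)
         (fun s => X s i 0) 0 t) /\
    signature X N 0 t =
      first_unitvec R m N +
      \sum_(i < m)
        RS_integral vscale (fun s => A_mx R N i *m signature X N 0 s)
          (fun s => X s i 0) 0 t.
Proof.
move=> t /andP[t0 tT].
have [V XV] := bounded_variation_controls hXbv.
have XiV i : controls 0 T V (fun x => X x i 0).
  move=> x y x0 xy yT; apply: le_trans (XV x y x0 xy yT).
  by apply: (le_trans _ (norm_entry_le _ i)); rewrite !mxE.
have Xic i : unif_cont 0 T (fun x => X x i 0) by exact: entry_unif_cont.
have Ic k q := (iterated_integral_regular XiV Xic (ltW hT) (k := k) q).1.
have word0 (r : 'I_(sigdim m N.+1)) (q : 'I_(m ^ 0)) :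
    r = (sigdim m 0 + q)%N :> nat -> r = 0%N :> nat.
  by move->; rewrite /sigdim big_ord0; case: q => -[|].
have integrandc i (r : 'I_(sigdim m N.+1)) :
    unif_cont 0 t (fun s => (A_mx R N i *m signature X N 0 s) r 0).
  apply: unif_contS tT _; have [[|k] [q [kN rE]]] := split_signature_index r.
    rewrite (_ : (fun s => _) = fun=> 0); first exact: unif_cont_cst.
    by apply/funext => s; rewrite A_mx_mul_entry0 // (word0 r q).
  have [q' [l qE]] := split_word_index q.
  rewrite (_ : (fun s => _) = fun s =>
    (l == i)%:R * iterated_integral X 0 k s q' 0); last first.
    by apply/funext => s; rewrite (@A_mx_signature _ _ X N 0 k q' l i) // rE qE.
  case: eqP => _ /=.
    by under eq_fun do rewrite mul1r; exact: Ic.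
  by under eq_fun do rewrite mul0r; exact: unif_cont_cst.
(* [J i]: the integral against the i-th coordinate exists and is computed entry
   by entry *)
have J i := @RS_integral_entries R _ _ _ vscale
  (fun s => A_mx R N i *m signature X N 0 s) (fun s => X s i 0)
  (fun r s => (A_mx R N i *m signature X N 0 s) r 0) (fun r s => X s i 0) 0 t V t0
  (ltac:(by move=> r x y z; rewrite /vscale mxE mulrC))
  (integrandc i) (fun r => controlsS tT (XiV i)).
split; first by move=> i; case: (J i).
have J0 i r : (forall s, (A_mx R N i *m signature X N 0 s) r 0 = 0) ->
    RS_integral vscale (fun s => A_mx R N i *m signature X N 0 s)
          (fun s => X s i 0) 0 t r 0 = 0.
  move=> z; have [_ /(_ r) iJ] := J i.
  apply/eqP; rewrite -normr_le0 (le_trans (is_rsint_bound (B := 0) t0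
    (controlsS tT (XiV i)) _ iJ)) ?mul0r // => x _ _.
  by rewrite z normr0.
apply/matrixP => r c; rewrite (ord1 c) [RHS]mxE [X in _ = X + _]mxE summxE.
(* the entry at the empty word, then at the word q' l of length k + 1 *)
have [[|k] [q [kN rE]]] := split_signature_index r.
  rewrite (@signature_entry _ _ X N 0 t 0 q r) // mxE (word0 r q) // eqxx.
  rewrite big1 ?addr0 // => i _; apply: J0 => s.
  by rewrite A_mx_mul_entry0 // (word0 r q).
have [q' [l qE]] := split_word_index q.
have AE i s : (A_mx R N i *m signature X N 0 s) r 0 =
    (l == i)%:R * iterated_integral X 0 k s q' 0.
  by rewrite (@A_mx_signature _ _ X N 0 k q' l i) // rE qE.
rewrite (@signature_entry _ _ X N 0 t k.+1 q r) // rE sigdim_succ add0r.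
rewrite (bigD1 l) //= big1 ?addr0; last first.
  move=> i il; apply: J0 => s.
  by rewrite AE eq_sym (negbTE il) mul0r.
have [_ /(_ r)] := J l; rewrite (_ : (fun s => _) = fun s =>
    iterated_integral X 0 k s q' 0); last first.
  by apply/funext => s; rewrite AE eqxx mul1r.
apply: (is_rsint_unique t0).
exact: (iterated_integral_step XiV (fun i => Ic k i) t0 tT qE).
Qed.
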